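(* Let $s\ge 2$ and $n_1,\ldots,n_s\ge 1$ be integers, let $n=n_1+\cdots+n_s$, and let $K_{n_1,\ldots,n_s}$ be the complete $s$-partite graph with partition sets $X_1,\ldots,X_s$, $|X_i|=n_i$. Let $F$ be a spanning forest of $K_{n_1,\ldots,n_s}$ with components $T_1,\ldots,T_c$. For $i\in\{1,\ldots,s\}$ and $p\in\{1,\ldots,c\}$ put $n_{ip}=|X_i\cap V(T_p)|$, $m_p=|V(T_p)|$ and $\alpha_p=nm_p-\sum_{i=1}^s n_in_{ip}$. Let $M$ be the $s\times s$ matrix whose $(k,l)$ entry is $$M_{kl}=\delta_{kl}-\sum_{p=1}^c\frac{n_{lp}(m_p-n_{kp})}{\alpha_p}.$$ Then for any $i,j\in\{1,\ldots,s\}$, $$\tau_F(K_{n_1,\ldots,n_s})=\frac{C_{ij}}{n_i(n-n_j)}\prod_{p=1}^c\alpha_p,$$ where $C_{ij}$ is the cofactor of $M$ corresponding to the $(i,j)$ entry.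
   Context: For a graph $G$ and a spanning subgraph $H$, $\tau_H(G)$ denotes the number of spanning trees of $G$ that contain all edges of $H$. $\delta_{kl}$ is the Kronecker delta. The cofactor $C_{ij}$ of an $s\times s$ matrix $M$ is $(-1)^{i+j}$ times the determinant of the matrix obtained from $M$ by deleting row $i$ and column $j$. *)

(* Defs.v *)
From HB Require Import structures.
From mathcomp Require Import all_boot all_order all_algebra.
Set Implicit Arguments.
Unset Strict Implicit.
Unset Printing Implicit Defensive.

Import Order.TTheory GRing.Theory Num.Theory.

(* A simple graph on the vertex type V is given by its edge set, a set of     *)
(* two-element subsets of V; its spanning subgraphs are the subsets of it.    *)
Section Graphs.
Variable V : finType.
Implicit Types E F G H T : {set {set V}}.

Definition adj E : rel V := [rel u v | [set u; v] \in E].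

Definition connected_graph E := [forall u, forall v, connect (adj E) u v].

(* Repetition-free closed walks have at most #|V| vertices, hence the bound   *)
(* on k, which makes the condition decidable (see acyclicP).                  *)
Definition acyclic E :=
  [forall k : 'I_#|V|.+1, forall c : k.-tuple V,
     (2 < k) ==> ~~ ucycleb (adj E) c].

Lemma acyclicP E :
  reflect (forall c : seq V, 2 < size c -> ~ ucycle (adj E) c) (acyclic E).
Proof.
apply: (iffP forallP) => [acE c c_gt2 ucE | acE k].
  have uc : uniq c by case/andP: ucE.
  have ltc : size c < #|V|.+1 by rewrite ltnS -(card_uniqP uc) max_card.
  have /forallP/(_ (in_tuple c)) := acE (Ordinal ltc).
  by rewrite /= c_gt2 => /negP; apply.
apply/forallP => c; apply/implyP => k_gt2; apply/negP.
by apply: acE; rewrite size_tuple.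
Qed.

Definition spanning_forest G F := (F \subset G) && acyclic F.

Definition spanning_tree G T := spanning_forest G T && connected_graph T.

Definition components E : {set {set V}} :=
  [set [set v | connect (adj E) u v] | u : V].

Definition tau H G : nat :=
  #|[set T | spanning_tree G T && (H \subset T)]|.

End Graphs.

Section CompleteMultipartite.
Variables (s : nat) (n : 'I_s -> nat).

(* A vertex is a pair (i, a): the a-th element of the partition set X_i.      *)
Definition mvertex : finType := {i : 'I_s & 'I_(n i)}.

Definition part (i : 'I_s) : {set mvertex} := [set v | tag v == i].

Lemma card_part i : #|part i| = n i.
Proof.
have inj : injective (fun a : 'I_(n i) => Tagged (fun k => 'I_(n k)) a : mvertex).
  by move=> a b /eqP; rewrite -tag_eqE /tag_eq /= eqxx tagged_asE => /eqP.
rewrite -[RHS]card_ord -(card_image inj); apply: eq_card => v; rewrite inE.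
apply/eqP/imageP => [<-|[a _ ->]] //.
by exists (tagged v); rewrite ?taggedK //; case: v.
Qed.

Definition complete_multipartite : {set {set mvertex}} :=
  [set e | [exists u : mvertex, exists v : mvertex,
     (tag u != tag v) && (e == [set u; v])]].

Local Open Scope ring_scope.

Definition order_total : nat := (\sum_i n i)%N.

Definition npart (i : 'I_s) (P : {set mvertex}) : nat := #|part i :&: P|.

Definition alpha (P : {set mvertex}) : rat :=
  order_total%:R * #|P|%:R - \sum_i (n i)%:R * (npart i P)%:R.

Definition forest_mx (F : {set {set mvertex}}) : 'M[rat]_s :=
  \matrix_(k, l) ((k == l)%:R
    - \sum_(P in components F)
        (npart l P)%:R * (#|P|%:R - (npart k P)%:R) / alpha P).

End CompleteMultipartite.

(* Main.v *)
Require Import Defs.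
From HB Require Import structures.
From mathcomp Require Import all_boot all_order all_algebra.
Import Order.TTheory GRing.Theory Num.Theory.
Local Open Scope ring_scope.
Set Implicit Arguments.
Unset Strict Implicit.
Unset Printing Implicit Defensive.

(* Let L be the Laplacian of the multigraph obtained from G by contracting the
   components of F.  Deleting from L the row and column of a fixed component C
   leaves a determinant equal to tau_F(G): pick an edge e leaving C and compare
   tau_F(G) = tau_F(G - e) + tau_(F + e)(G) with the expansion of the determinant
   at the diagonal entry of the component that e joins to C.  Contraction only
   enlarges C, so the remaining components, which index the matrix, persist.

   For G complete multipartite, L = D - X Y with D = diag(alpha_p),
   X_(p,k) = n_kp and Y_(k,p) = m_p - n_kp, and M = 1 - Y D^-1 X.  By Sylvester's
   identity the reduced determinant is prod_(p <> C) alpha_p * det (M + u v) with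
   u v = Y_(.,C) X_(C,.) / alpha_C.  Since M kills the column x_k = n - n_k and
   the row y_k = n_k, its cofactors are proportional to y_i x_j, which gives
   det (M + u v) y_i x_j = (v x) (y u) C_ij = alpha_C C_ij. *)

(** * Sylvester's identity, Cramer's rule and rank-one updates of singular matrices *)

(** Both sides are the determinant of the block matrix with identity diagonal blocks and
    off-diagonal blocks [A] and [B], eliminated in two ways. *)
Lemma det_1subM_comm (R : comNzRingType) m n (A : 'M[R]_(m, n)) (B : 'M_(n, m)) :
  \det (1%:M - A *m B) = \det (1%:M - B *m A).
Proof.
transitivity (\det (block_mx 1%:M A B 1%:M)).
  rewrite (_ : block_mx _ _ _ _ =
    block_mx 1%:M A 0 1%:M *m block_mx (1%:M - A *m B) 0 B 1%:M).
    by rewrite det_mulmx det_ublock det_lblock !det1 !mul1r mulr1.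
  by rewrite mulmx_block !mul1mx !mul0mx !mulmx1 subrK !add0r.
rewrite (_ : block_mx _ _ _ _ =
  block_mx 1%:M 0 B 1%:M *m block_mx 1%:M A 0 (1%:M - B *m A)).
  by rewrite det_mulmx det_ublock det_lblock !det1 !mul1r.
by rewrite mulmx_block !mul1mx !mul0mx !mulmx1 !addr0 addrC subrK.
Qed.

Definition replace_col (R : nzRingType) m n (A : 'M[R]_(m, n)) (j : 'I_n) (u : 'cV_m) :=
  \matrix_(k, l) if l == j then u k 0 else A k l.

Lemma cofactor_replace_col (R : nzRingType) n (A : 'M[R]_n) i j u :
  cofactor (replace_col A j u) i j = cofactor A i j.
Proof.
rewrite /cofactor; congr (_ * \det _); apply/matrixP => k l.
by rewrite !mxE eq_sym (negPf (neq_lift _ _)).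
Qed.

(** Cramer's rule: expand along column [j], whose cofactors do not see the replacement. *)
Lemma det_replace_col (R : comNzRingType) n (A : 'M[R]_n) j u :
  \det (replace_col A j u) = (\adj A *m u) j 0.
Proof.
rewrite (expand_det_col _ j) mxE; apply: eq_bigr => i _.
by rewrite cofactor_replace_col !mxE eqxx mulrC.
Qed.

(** By Cramer's rule, entry [j] of each side is a determinant whose column [j] is [u]; the update
    then only adds multiples of that column to the others. *)
Lemma adj_rank1_update (R : comNzRingType) n (A : 'M[R]_n) (u : 'cV_n) (v : 'rV_n) :
  \adj (A + u *m v) *m u = \adj A *m u.
Proof.
apply/colP => j; rewrite -!det_replace_col.
(* Entry [j] of [v] is dropped because column [j] has been overwritten; the column operation
   therefore has determinant 1. *)
pose v' : 'rV[R]_n := \row_l (v 0 l *+ (l != j)).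
rewrite (_ : replace_col (A + _) j u =
   replace_col A j u *m (1%:M - - delta_mx j 0 *m v')).
  rewrite det_mulmx det_1subM_comm mulmxN opprK det_mx11 !mxE big1 ?addr0 ?mulr1 //.
  by move=> l _; rewrite !mxE eqxx andbT; case: eqVneq => _; rewrite ?mul0r ?mulr0.
rewrite mulNmx opprK mulmxDr mulmx1 mulmxA -colE.
apply/matrixP => k l; rewrite !mxE !big_ord_recl !big_ord0 !addr0 !mxE eqxx.
by case: eqVneq => _; rewrite ?mulr0 ?addr0.
Qed.

(** Replacing column [j] by a combination of two unit vectors that [y] annihilates keeps [y] in the
    left kernel; the vanishing determinant is the difference of the two sides. *)
Lemma cofactor_left_kernel (R : fieldType) n (A : 'M[R]_n) (y : 'rV_n) i k j :
  y *m A = 0 -> y 0 k * cofactor A i j = y 0 i * cofactor A k j.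
Proof.
move=> yA0; have [->|y_neq0] := eqVneq y 0; first by rewrite !mxE !mul0r.
pose w : 'cV[R]_n := y 0 k *: delta_mx i 0 - y 0 i *: delta_mx k 0.
have yw : y *m w = 0.
  apply/matrixP => a b; rewrite !ord1 /w mulmxBr -!scalemxAr -!colE !mxE mulrC.
  by rewrite subrr.
have : \det (replace_col A j w) = 0.
  apply/eqP/det0P; exists y => //; apply/rowP => l; rewrite !mxE.
  have [->|lj] := eqVneq l j.
    transitivity ((y *m w) 0 0); last by rewrite yw mxE.
    by rewrite mxE; apply: eq_bigr => a _; rewrite mxE eqxx.
  transitivity ((y *m A) 0 l); last by rewrite yA0 mxE.
  by rewrite mxE; apply: eq_bigr => a _; rewrite mxE (negPf lj).
rewrite det_replace_col /w mulmxBr -!scalemxAr -!colE !mxE.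
by move/eqP; rewrite subr_eq0 => /eqP.
Qed.

(** Since [B] maps [x] to a multiple of [u], applying [\adj B] expresses [\det B] times [x] through
    [\adj A *m u]; the left kernel then reduces every cofactor in column [j] to the one at
    [(i, j)]. *)
Lemma det_rank1_update_kernel (R : fieldType) n (A : 'M[R]_n)
    (x u : 'cV_n) (y v : 'rV_n) i j :
    A *m x = 0 -> y *m A = 0 ->
  \det (A + u *m v) * y 0 i * x j 0 =
  (v *m x) 0 0 * (y *m u) 0 0 * cofactor A i j.
Proof.
move=> Ax0 yA0; set B := A + u *m v.
have Bx : B *m x = (v *m x) 0 0 *: u.
  by rewrite mulmxDl Ax0 add0r -mulmxA {1}[v *m x]mx11_scalar mul_mx_scalar.
have := congr1 (fun z : 'cV_n => z j 0) (congr1 (mulmx (\adj B)) Bx).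
rewrite mulmxA mul_adj_mx mul_scalar_mx -scalemxAr /= adj_rank1_update.
rewrite !(mxE _ _ j 0) mulrAC => ->.
rewrite -!mulrA; congr (_ * _); rewrite [(y *m u) _ _]mxE !mulr_suml.
apply: eq_bigr => k _; rewrite mxE [RHS]mulrAC.
by rewrite (cofactor_left_kernel i k j yA0) mulrC mulrA.
Qed.

(** * Principal minors indexed by subsets of a finite type *)

Section PrincipalMinor.
Variables (R : fieldType) (I : finType).
Implicit Types (S : {set I}) (A B : I -> I -> R).

(* Indices outside [S] carry an identity block, so the size of the matrix does
   not depend on [S]. *)
Definition pminor_mx S A : 'M[R]_#|I| :=
  \matrix_(p, q) if (enum_val p \in S) && (enum_val q \in S)
                 then A (enum_val p) (enum_val q) else (p == q)%:R.

Definition pminor S A : R := \det (pminor_mx S A).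

Lemma eq_pminor S A B : {in S &, A =2 B} -> pminor S A = pminor S B.
Proof.
move=> eqAB; congr (\det _); apply/matrixP => p q; rewrite !mxE.
by case: ifP => // /andP[Sp Sq]; rewrite eqAB.
Qed.

Lemma pminor_set0 A : pminor set0 A = 1.
Proof. by rewrite -(det1 R #|I|); congr (\det _); apply/matrixP => p q; rewrite !mxE inE. Qed.

(** The indicator row of [S] is a nonzero left kernel vector; it vanishes on the identity block. *)
Lemma pminor_kernel S A :
  S != set0 -> (forall Q, Q \in S -> \sum_(P in S) A P Q = 0) -> pminor S A = 0.
Proof.
case/set0Pn => P0 SP0 A0; apply/eqP/det0P.
exists (\row_p (enum_val p \in S)%:R).
  apply/eqP => /rowP/(_ (enum_rank P0)); rewrite !mxE enum_rankK SP0.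
  by apply/eqP/oner_neq0.
apply/rowP => q; rewrite !mxE.
pose f P := if P \in S then if enum_val q \in S then A P (enum_val q) else 0 else 0.
transitivity (\sum_(p < #|I|) f (enum_val p)).
  apply: eq_bigr => p _; rewrite !mxE /f; case Sp: (_ \in S) => /=; last by rewrite mul0r.
  rewrite mul1r; case: ifP => // Sq.
  by case: eqVneq Sp => [->|//]; rewrite Sq.
rewrite -(big_enum_val f) /f -big_mkcondr /=.
by case: (boolP (_ \in S)) => [/A0 //|_]; rewrite big1.
Qed.

(** Row [P] for [A] is row [P] for [B] plus a unit vector, and the determinant is linear in that
    row. This mirrors deletion-contraction. *)
Lemma pminor_add_diag S A B P :
    P \in S -> A P P = B P P + 1 ->
    (forall Q1 Q2, Q1 \in S -> Q2 \in S -> (Q1 != P) || (Q2 != P) -> A Q1 Q2 = B Q1 Q2) ->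
  pminor S A = pminor S B + pminor (S :\ P) B.
Proof.
move=> SP APP AB; set p := enum_rank P; have pP : enum_val p = P by exact: enum_rankK.
have eqp a : (enum_val a == P) = (a == p) by rewrite -pP (inj_eq enum_val_inj).
(* Only row [P] becomes a unit row here. Column [P] still differs from that of the matrix for
   [S :\ P], but expansion along row [P] does not see it. *)
pose C : 'M[R]_#|I| := \matrix_(a, b) if a == p then (b == p)%:R else pminor_mx S A a b.
have -> : pminor (S :\ P) B = \det C.
  rewrite /pminor (expand_det_row _ p) [RHS](expand_det_row _ p).
  apply: eq_bigr => b _; rewrite !mxE eqxx pP !inE eqxx /=.
  rewrite (eq_sym p); case: (eqVneq b p) => [->|bp]; last by rewrite !mul0r.
  rewrite /cofactor; congr (_ * (_ * \det _)); apply/matrixP => k l.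
  rewrite !mxE ![lift p _ == p]eq_sym (negPf (neq_lift _ _)) !inE !eqp.
  rewrite ![lift p _ == p]eq_sym !(negPf (neq_lift _ _)) /=.
  case: ifP => // /andP[Sk Sl]; rewrite AB //.
  by rewrite eqp eq_sym neq_lift.
rewrite /pminor (@determinant_multilinear _ _ _ (pminor_mx S B) C p 1 1) ?mul1r //.
- apply/rowP => b; rewrite !mxE eqxx pP SP /= !mul1r.
  have [->|bp] := eqVneq b p; first by rewrite pP SP.
  by case: ifP => [Sb|_]; rewrite ?addr0 // AB // eqp bp orbT.
- apply/matrixP => k l; rewrite !mxE; case: ifP => // /andP[Sk Sl].
  by rewrite AB // eqp eq_sym neq_lift.
by apply/matrixP => k l; rewrite !mxE eq_sym (negPf (neq_lift _ _)).
Qed.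

(** Factoring out the diagonal leaves an identity minus a product, to which Sylvester's identity
    applies: the size drops from the components to the partition sets. *)
Lemma pminor_diag_sub_mul S A d m (X : I -> 'I_m -> R) (Y : 'I_m -> I -> R) :
    (forall P, P \in S -> d P != 0) ->
    (forall P Q, P \in S -> Q \in S ->
       A P Q = (P == Q)%:R * d P - \sum_k X P k * Y k Q) ->
  pminor S A = (\prod_(P in S) d P) *
    \det (1%:M - \matrix_(k, l) \sum_(P in S) Y k P * X P l / d P).
Proof.
move=> d_neq0 AE.
(* The value 1 outside [S] reproduces the identity block and contributes nothing to the product. *)
pose D : 'rV[R]_#|I| := \row_p if enum_val p \in S then d (enum_val p) else 1.
pose X' : 'M[R]_(#|I|, m) :=
  \matrix_(p, k) if enum_val p \in S then X (enum_val p) k / d (enum_val p) else 0.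
pose Y' : 'M[R]_(m, #|I|) :=
  \matrix_(k, p) if enum_val p \in S then Y k (enum_val p) else 0.
have -> : pminor S A = \det (diag_mx D *m (1%:M - X' *m Y')).
  congr (\det _); apply/matrixP => p q; rewrite mul_diag_mx !mxE.
  case: ifP => [/andP[Sp Sq]|nS].
    rewrite Sp AE // (inj_eq enum_val_inj) mulrBr mulrC mulr_sumr; congr (_ - _).
    apply: eq_bigr => k _; rewrite !mxE Sp Sq mulrA; congr (_ * _).
    by rewrite mulrC divfK ?d_neq0.
  rewrite big1 => [|k _]; last first.
    by rewrite !mxE; move: nS; case: (_ \in S); case: (_ \in S); rewrite ?mulr0 ?mul0r.
  rewrite subr0; case: (eqVneq p q) nS => [<-|_ _]; last by rewrite mulr0.
  by rewrite andbb => ->; rewrite mulr1.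
rewrite det_mulmx det_diag det_1subM_comm.
congr (_ * _); last congr (\det (_ - _)).
  pose f P := if P \in S then d P else 1.
  rewrite (eq_bigr (fun p => f (enum_val p))); last by move=> p _; rewrite mxE.
  by rewrite -(big_enum_val f) /f -big_mkcondr.
apply/matrixP => k l; rewrite !mxE.
pose f P := if P \in S then Y k P * X P l / d P else 0.
rewrite (eq_bigr (fun p => f (enum_val p))); last first.
  by move=> p _; rewrite !mxE /f; case: ifP => _; rewrite ?mul0r ?mulrA.
by rewrite -(big_enum_val f) /f -big_mkcondr.
Qed.

End PrincipalMinor.

(** * Bridges, acyclicity, deletion-contraction and components *)

Section Forests.
Variable V : finType.
Implicit Types (E F G T : {set {set V}}) (u v w : V).

Lemma eq_set2 u v w z :
  [set u; v] = [set w; z] -> u = w /\ v = z \/ u = z /\ v = w.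
Proof.
move=> eqs; have: u \in [set w; z] by rewrite -eqs set21.
have: v \in [set w; z] by rewrite -eqs set22.
have: w \in [set u; v] by rewrite eqs set21.
have: z \in [set u; v] by rewrite eqs set22.
rewrite !inE => /orP[]/eqP? /orP[]/eqP? /orP[]/eqP? /orP[]/eqP?; subst; auto.
Qed.

Lemma adj_sym E : symmetric (adj E).
Proof. by move=> u v; rewrite /adj /= setUC. Qed.

Lemma adj_connect_sym E : connect_sym (adj E).
Proof. exact: sym_connect_sym (adj_sym E). Qed.

Lemma sub_connect_adj E F u v :
  E \subset F -> connect (adj E) u v -> connect (adj F) u v.
Proof.
move=> sEF; apply: connect_sub => x y xy; apply: connect1.
exact: (subsetP sEF).
Qed.

(** A path needs the new edge at most once, in one of its two directions. *)
Lemma connect_adjU1 E u v x y :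
    connect (adj ([set u; v] |: E)) x y ->
  [\/ connect (adj E) x y,
      connect (adj E) x u /\ connect (adj E) v y |
      connect (adj E) x v /\ connect (adj E) u y].
Proof.
case/connectP => p; elim: p x => [|z p IHp] x /= => [_ ->|/andP[xz pzp] ey].
  by constructor 1.
have := IHp z pzp ey; move: xz; rewrite /adj /= !inE => /orP[/eqP/eq_set2|xz].
  case=> -[-> ->] [zy|[zu vy]|[zv uy]].
  - by constructor 2.
  - by constructor 2.
  - by constructor 1.
  - by constructor 3.
  - by constructor 1.
  - by constructor 3.
have cxz := @connect1 _ (adj E) x z xz.
by case=> [zy|[zu vy]|[zv uy]]; [constructor 1|constructor 2|constructor 3];
  rewrite ?(connect_trans cxz).
Qed.

(** A path avoiding the edge would close up to a cycle with it. *)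
Lemma acyclic_bridge E u v : acyclic E -> [set u; v] \in E -> u != v ->
  ~~ connect (adj (E :\ [set u; v])) u v.
Proof.
move=> /acyclicP acE Euv neq_uv; apply/negP => /connectP[p0 pth0 v_last].
case/shortenP: pth0 v_last => p pth uniq_p _ v_last {p0}.
case: p pth uniq_p v_last => [|x p] /=.
  by move=> _ _ vu; rewrite vu eqxx in neq_uv.
case/andP=> ux pth uniq_p v_last.
have subE : subrel (adj (E :\ [set u; v])) (adj E).
  by move=> a b; rewrite /adj /= !inE => /andP[].
(* The cycle has more than two vertices: a one-step path from [u] to [v] would be the deleted
   edge. *)
apply: (acE [:: u, x & p]).
  by case: p v_last ux {pth uniq_p} => //= <-; rewrite /adj /= !inE eqxx.
apply/andP; split=> //=; rewrite (subE _ _ ux) rcons_path (sub_path subE pth) /=.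
by rewrite -v_last /adj /= setUC.
Qed.

(** Going around a cycle the other way bypasses its first edge, which is then no bridge. *)
Lemma bridges_acyclic E :
    (forall u v, [set u; v] \in E -> u != v ->
       ~~ connect (adj (E :\ [set u; v])) u v) ->
  acyclic E.
Proof.
move=> bridgeE; apply/acyclicP => -[//|x [//|y [//|z c]]] _ /andP[cyc unq].
move: cyc => /= /and3P[xy yz pth]; move: unq; rewrite /= !inE !negb_or.
case/and4P=> /and3P[neq_xy neq_xz xNc] /andP[neq_yz yNc] zNc unq.
have /negP[] := bridgeE x y xy neq_xy; rewrite adj_connect_sym.
apply/connectP; exists (z :: rcons c x); last by rewrite /= last_rcons.
(* Each step of the bypass has an endpoint other than [x] and [y], so it survives the deletion. *)
have off a b : adj E a b -> a \notin [:: x; y] -> adj (E :\ [set x; y]) a b.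
  move=> ab; rewrite !inE negb_or => /andP[ax ay]; rewrite /adj /= in_setD1 [_ \in E]ab andbT.
  by apply/eqP => /eq_set2[] [] ? _; subst; rewrite eqxx in ax ay.
apply/andP; split.
  by rewrite adj_sym off // 1?adj_sym // !inE negb_or ![z == _]eq_sym neq_xz.
elim: c z pth neq_xz neq_yz xNc yNc {zNc unq yz} => [|b c IHc] a /= /andP[ab pth] xa ya.
  by move=> _ _; rewrite andbT off // !inE negb_or ![a == _]eq_sym xa.
rewrite !inE !negb_or => /andP[xb xc] /andP[yb yc].
by rewrite off ?IHc // !inE negb_or ![a == _]eq_sym xa.
Qed.

(** Every edge remains a bridge: a bypass of an old edge would have to use the new one, and together
    with the old edge would connect [u] to [v] in [F]. *)
Lemma acyclicU1 F u v :
  acyclic F -> ~~ connect (adj F) u v -> acyclic ([set u; v] |: F).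
Proof.
move=> acF uNv; apply: bridges_acyclic => x y.
have euvNF : [set u; v] \notin F by apply: contra uNv => /(@connect1 _ (adj F)).
rewrite !inE; case: (eqVneq [set x; y] [set u; v]) => [exy _ _|nexy /= Fxy neq_xy].
  rewrite exy setU1K //; apply: contra uNv.
  by case: (eq_set2 exy) => -[-> ->] //; rewrite adj_connect_sym.
have -> : ([set u; v] |: F) :\ [set x; y] = [set u; v] |: (F :\ [set x; y]).
  by apply/setP => e; rewrite !inE; case: eqVneq => // ->; rewrite (negPf nexy).
have subF : F :\ [set x; y] \subset F by rewrite subD1set.
have xNy := acyclic_bridge acF Fxy neq_xy.
have cxy : connect (adj F) x y by apply: connect1.
apply/negP => /connect_adjU1[|[xu vy]|[xv uy]]; first exact/negP.
  case/negP: uNv; apply: connect_trans (_ : connect _ y v).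
    by apply: connect_trans cxy; rewrite adj_connect_sym (sub_connect_adj subF).
  by rewrite adj_connect_sym (sub_connect_adj subF).
case/negP: uNv; rewrite adj_connect_sym; apply: connect_trans (_ : connect _ y u).
  by apply: connect_trans cxy; rewrite adj_connect_sym (sub_connect_adj subF).
by rewrite adj_connect_sym (sub_connect_adj subF).
Qed.

(** An edge of [T] outside [F] would be bypassed inside [F]. Edges are required to be pairs because
    [acyclic] does not see other sets. *)
Lemma acyclic_super_connected F T :
    {in T, forall e : {set V}, #|e| == 2%N} -> acyclic T -> F \subset T ->
  connected_graph F -> T = F.
Proof.
move=> T2 acT sFT /forallP connF; apply/eqP; rewrite eqEsubset sFT andbT.
apply/subsetP => e Te; have /cards2P[u [v [neq_uv Ee]]] := T2 e Te; apply: contraTT Te => NFe.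
rewrite Ee; apply/negP => Tuv; have /negP[] := acyclic_bridge acT Tuv neq_uv.
apply: sub_connect_adj (forallP (connF u) v).
by rewrite subsetD1 sFT -Ee.
Qed.

(** Trees are sorted by whether they contain [e]; contracting [e] amounts to adding it to the
    forest. *)
Lemma tau_delete_contract F G e : e \in G -> e \notin F ->
  tau F G = (tau F (G :\ e) + tau (e |: F) G)%N.
Proof.
move=> Ge NFe; rewrite /tau -(cardsID [set T : {set {set V}} | e \in T]) addnC.
congr (_ + _)%N; apply: eq_card => T.
  rewrite !inE /spanning_tree /spanning_forest subsetD1.
  by case: (T \subset G); case: (e \in T); rewrite /= ?andbF ?andbT.
by rewrite !inE subUset sub1set; case: (e \in T); rewrite ?andbF ?andbT.
Qed.

Definition component F u : {set V} := [set v | connect (adj F) u v].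

Lemma in_component F u v : (v \in component F u) = connect (adj F) u v.
Proof. by rewrite inE. Qed.

Lemma eq_component F u v :
  (component F u == component F v) = connect (adj F) u v.
Proof.
apply/eqP/idP => [eq_uv|uv].
  by rewrite -in_component eq_uv in_component connect0.
by apply/setP => w; rewrite !in_component (same_connect (adj_connect_sym F) uv).
Qed.

Lemma component_in F u : component F u \in components F.
Proof. exact: imset_f. Qed.

Lemma componentsP F (P : {set V}) :
  reflect (exists u, P = component F u) (P \in components F).
Proof. by apply: (iffP imsetP) => [[u _ ->]|[u ->]]; exists u. Qed.

Lemma mem_component F P u : P \in components F -> (u \in P) = (component F u == P).
Proof.
case/componentsP => w ->; rewrite in_component eq_component.
exact: adj_connect_sym.
Qed.

Lemma sum_components (M : nmodType) F (f : V -> M) :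
  \sum_(P in components F) \sum_(u in P) f u = \sum_u f u.
Proof.
rewrite [RHS](partition_big (component F) (mem (components F))) /=; last first.
  by move=> u _; exact: component_in.
by apply: eq_bigr => P FP; apply: eq_bigl => u; rewrite (mem_component u FP).
Qed.

(** The new edge merges the component of [v] into that of [r] and leaves all others unchanged as
    sets, so the index set of the minor just loses one element. *)
Lemma components_contract F r u v :
    connect (adj F) r u -> ~~ connect (adj F) r v ->
  components ([set u; v] |: F) :\ component ([set u; v] |: F) r =
  components F :\ component F r :\ component F v.
Proof.
move=> ru rNv; set F' := _ |: F.
have sF : F \subset F' by exact: subsetUr.
have csym := adj_connect_sym.
(* The enlarged component of [r] is the union of the old components of [r] and [v]. *)
have r'w w : connect (adj F') r w = connect (adj F) r w || connect (adj F) v w.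
  apply/idP/orP => [/connect_adjU1[|[_]|[rv]]|[]]; [by left|by right| | |].
  - by rewrite rv in rNv.
  - exact: sub_connect_adj.
  move/(sub_connect_adj sF); apply: connect_trans.
  apply: connect_trans (sub_connect_adj sF ru) (connect1 _).
  by rewrite /adj /= setU11.
have comp' w : ~~ connect (adj F') r w -> component F' w = component F w.
  rewrite r'w negb_or => /andP[rNw vNw]; apply/setP => z; rewrite !in_component.
  apply/idP/idP => [/connect_adjU1[//|[wu _]|[wv _]]|]; last exact: sub_connect_adj.
    by case/negP: rNw; apply: connect_trans ru _; rewrite csym.
  by case/negP: vNw; rewrite csym.
apply/setP => P; apply/idP/idP.
  rewrite !in_setD1 => /andP[neq /componentsP[w ePw]]; move: neq.
  rewrite {}ePw eq_component csym => rNw; rewrite comp' // component_in.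
  rewrite !eq_component ![connect _ w _]csym.
  by move: rNw; rewrite r'w negb_or andbT andbC.
rewrite !in_setD1 => /and3P[neqv neqr /componentsP[w ePw]]; move: neqv neqr.
rewrite {}ePw !eq_component => wNv wNr.
have rNw : ~~ connect (adj F') r w by rewrite r'w negb_or ![connect _ _ w]csym wNr.
by rewrite -(comp' _ rNw) component_in eq_component csym rNw.
Qed.

(** * The matrix-tree theorem for trees containing a given forest *)

Section MatrixTree.
Variable R : fieldType.

(* Edges of [G] inside a component cancel between the two terms, so this is the
   Laplacian of the contracted multigraph. *)
Definition laplacian G (P Q : {set V}) : R :=
  (P == Q)%:R * (\sum_(a in P) \sum_b (adj G a b)%:R)
  - \sum_(a in P) \sum_(b in Q) (adj G a b)%:R.

(** With [u] outside [P] and [Q], the edge is counted only in the degree sum of a diagonal entry,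
    once, at [v]. *)
Lemma laplacian_delete G u v (P Q : {set V}) :
    [set u; v] \in G -> u \notin P -> u \notin Q ->
  laplacian G P Q = laplacian (G :\ [set u; v]) P Q + ((P == Q) && (v \in P))%:R.
Proof.
move=> Guv uNP uNQ; set G' := G :\ _.
have adjE a b : a != u -> (adj G a b)%:R = (adj G' a b)%:R + ((a == v) && (b == u))%:R :> R.
  move=> au; rewrite /adj /= !inE.
  have [eab|neq] := eqVneq [set a; b] [set u; v].
    case: (eq_set2 eab) => -[ea eb]; first by rewrite ea eqxx in au.
    by rewrite eab Guv ea eb !eqxx add0r.
  case: eqP => [ea|_]; last by rewrite addr0.
  case: eqP => [eb|_]; last by rewrite addr0.
  by rewrite ea eb setUC eqxx in neq.
have aNu a : a \in P -> a != u by apply: contraTneq => ->.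
rewrite /laplacian.
have -> : \sum_(a in P) \sum_(b in Q) (adj G a b)%:R =
          \sum_(a in P) \sum_(b in Q) (adj G' a b)%:R :> R.
  apply: eq_bigr => a Pa; apply: eq_bigr => b Qb; rewrite adjE ?aNu //.
  have -> : (b == u) = false by apply: contraNF uNQ => /eqP <-.
  by rewrite andbF addr0.
have -> : \sum_(a in P) \sum_b (adj G a b)%:R =
          \sum_(a in P) \sum_b (adj G' a b)%:R + (v \in P)%:R :> R.
  under eq_bigr => a Pa do under eq_bigr => b _ do rewrite adjE ?aNu //.
  under eq_bigr do rewrite big_split; rewrite big_split /=; congr (_ + _).
  rewrite [RHS](_ : _ = \sum_(a in P) (a == v)%:R); last first.
    case: (boolP (v \in P)) => Pv.
      rewrite (bigD1 v) //= eqxx big1 ?addr0 // => a /andP[_ /negPf->] //.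
    by rewrite big1 // => a Pa; case: eqP => // ea; rewrite -ea Pa in Pv.
  apply: eq_bigr => a _; rewrite (bigD1 u) //= eqxx andbT big1 ?addr0 // => b /negPf->.
  by rewrite andbF.
by rewrite mulrDr addrAC; congr (_ + _); case: (P == Q); rewrite ?mul1r ?mul0r.
Qed.

(** Base case. If [r] reaches everything, [F] is the only tree and the minor is empty; otherwise no
    tree exists and the columns of the minor sum to zero. *)
Lemma tau_pminor_isolated F G r :
    {in G, forall e : {set V}, #|e| == 2%N} -> F \subset G -> acyclic F ->
    (forall u v, connect (adj F) r u -> ~~ connect (adj F) r v -> ~~ adj G u v) ->
  (tau F G)%:R = pminor (components F :\ component F r) (laplacian G).
Proof.
move=> G2 sFG acF noexit; have [S0|Sn0] := eqVneq (components F :\ component F r) set0.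
  have connF u v : connect (adj F) u v.
    suff rw w : connect (adj F) r w.
      by apply: connect_trans (rw v); rewrite adj_connect_sym.
    rewrite -eq_component eq_sym; apply: contraT => neq.
    have : component F w \in components F :\ component F r.
      by rewrite in_setD1 neq component_in.
    by rewrite S0 inE.
  have cF : connected_graph F by apply/forallP => u; apply/forallP => v.
  rewrite S0 pminor_set0 /tau (_ : [set _ | _] = [set F]) ?cards1 //.
  apply/setP => T; rewrite !inE; apply/idP/eqP => [|->]; last first.
    by rewrite /spanning_tree /spanning_forest sFG acF cF subxx.
  case/andP=> /andP[/andP[sTG acT] _] sFT.
  apply: acyclic_super_connected => // e Te.
  by apply: G2; apply: (subsetP sTG).
rewrite pminor_kernel //.
  rewrite /tau (_ : [set _ | _] = set0) ?cards0 //; apply/setP => T; rewrite !inE.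
  apply/negP => /andP[/andP[/andP[sTG _] /forallP connT] _].
  have /set0Pn[P] := Sn0; rewrite in_setD1 => /andP[neq /componentsP[w ePw]].
  rewrite ePw eq_component adj_connect_sym in neq.
  have /connectP[p pth lst] := forallP (connT r) w.
  (* A path in a tree [T], hence in [G], never leaves the component of [r]. *)
  suff cl : forall u, connect (adj F) r u -> path (adj T) u p -> connect (adj F) r (last u p).
    by rewrite lst cl ?connect0 in neq.
  elim: p {pth lst} => [//|z p IHp] u ru /= /andP[uz pzp]; apply: IHp => //.
  by apply: contraTT uz => /(noexit u z ru); apply: contra => /(subsetP sTG).
move=> Q; rewrite in_setD1 => /andP[neqQ FQ].
have QN a b : a \in component F r -> b \in Q -> ~~ adj G a b.
  rewrite in_component => ra Qb; apply: noexit => //.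
  by rewrite -eq_component eq_sym; rewrite (mem_component b FQ) in Qb; rewrite (eqP Qb).
have FQr : Q \in components F :\ component F r by rewrite in_setD1 neqQ.
rewrite sumrB (bigD1 Q) //= eqxx mul1r [X in _ + X - _]big1 ?addr0; last first.
  by move=> P /andP[_ /negPf->]; rewrite mul0r.
(* The component of [r] sends no edge to [Q], so the remaining components account for all edges into
   [Q]; symmetry of adjacency then gives the degree sum of [Q]. *)
have := sum_components F (fun a => \sum_(b in Q) (adj G a b)%:R : R).
rewrite (big_setD1 (component F r)) ?component_in //= big1 ?add0r; last first.
  by move=> a ra; rewrite big1 // => b Qb; rewrite (negPf (QN a b ra Qb)).
move=> ->; rewrite [X in _ - X]exchange_big /=; apply/eqP; rewrite subr_eq0; apply/eqP.
by apply: eq_bigr => b _; apply: eq_bigr => a _; rewrite adj_sym.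
Qed.

Lemma tau_pminor F G r :
    {in G, forall e : {set V}, #|e| == 2%N} -> F \subset G -> acyclic F ->
  (tau F G)%:R = pminor (components F :\ component F r) (laplacian G).
Proof.
(* Both deletion from [G] and addition to [F] decrease the number of edges of [G] outside [F]. *)
move: {2}#|G :\: F| (leqnn #|G :\: F|) => N; elim: N F G => [|N IHN] F G leN G2 sFG acF.
  apply: tau_pminor_isolated => // u v ru rNv; apply: contra rNv => Guv.
  rewrite leqn0 cards_eq0 setD_eq0 in leN.
  by apply: connect_trans ru (connect1 _); apply: (subsetP leN).
pose exits := [exists u, exists v,
  [&& connect (adj F) r u, ~~ connect (adj F) r v & adj G u v]].
have [/existsP[u /existsP[v /and3P[ru rNv Guv]]]|noexit] := boolP exits; last first.
  apply: tau_pminor_isolated => // u v ru rNv; apply: contra noexit => Guv.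
  by apply/existsP; exists u; apply/existsP; exists v; rewrite ru rNv.
set e := [set u; v]; have Ge : e \in G by [].
have uNv : ~~ connect (adj F) u v by apply: contra rNv; apply: connect_trans.
have NFe : e \notin F by apply: contra uNv => /(@connect1 _ (adj F)).
have card_lt : (#|(G :\: F) :\ e| <= N)%N.
  by rewrite -ltnS (leq_trans _ leN) // (cardsD1 e (G :\: F)) inE Ge NFe.
have notin_u P : P \in components F :\ component F r -> u \notin P.
  rewrite in_setD1 => /andP[neq FP]; rewrite (mem_component u FP).
  by apply: contra neq => /eqP<-; rewrite eq_component adj_connect_sym.
have Fv : component F v \in components F :\ component F r.
  by rewrite in_setD1 component_in eq_component adj_connect_sym rNv.
(* As [u] lies in the removed component, deleting [e] changes a single entry, on the diagonal at the
   component of [v]. *)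
have lapE : {in components F :\ component F r &, forall P Q, laplacian G P Q =
    laplacian (G :\ e) P Q + ((P == Q) && (P == component F v))%:R}.
  move=> P Q SP SQ; rewrite (laplacian_delete Ge) ?notin_u //.
  by move: SP; rewrite in_setD1 => /andP[_ FP]; rewrite (mem_component v FP) [_ == P]eq_sym.
rewrite (tau_delete_contract Ge NFe) natrD (pminor_add_diag Fv (B := laplacian (G :\ e))).
- congr (_ + _).
    apply: IHN; rewrite ?subsetD1 ?sFG //.
      by rewrite setDDl setUC -setDDl.
    by move=> f; rewrite in_setD1 => /andP[_ /G2].
  (* The contracted minor omits the component of [v], so [G] and [G :\ e] give the same entries
     there. *)
  rewrite (IHN (e |: F) G) ?components_contract //.
  + apply: eq_pminor => P Q; rewrite !(in_setD1 _ _ (component F v)).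
    move=> /andP[/negPf nP SP] /andP[_ SQ].
    by rewrite lapE // nP andbF addr0.
  + by rewrite setUC -setDDl.
  + by rewrite subUset sub1set Ge.
  exact: acyclicU1.
- by rewrite lapE // !eqxx.
move=> P Q SP SQ nPQ; rewrite lapE //; have [ePQ|_] := eqVneq P Q; last by rewrite addr0.
by move: nPQ; rewrite -ePQ orbb => /negPf->; rewrite addr0.
Qed.

End MatrixTree.
End Forests.

(** * Degrees and kernel vectors for the complete multipartite graph *)

Section Multipartite.
Variables (s : nat) (n : 'I_s -> nat).
Local Notation V := (mvertex n).
Local Notation G := (complete_multipartite n).
Implicit Types (P Q : {set V}) (F : {set {set V}}) (k l : 'I_s).

Lemma adj_multipartite (u v : V) : adj G u v = (tag u != tag v).
Proof.
rewrite /adj /= inE; apply/existsP/idP => [[a /existsP[b /andP[ab /eqP/eq_set2]]]|uv].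
  by case=> -[-> ->]; rewrite // eq_sym.
by exists u; apply/existsP; exists v; rewrite uv eqxx.
Qed.

Lemma card_edge_multipartite : {in G, forall e : {set V}, #|e| == 2%N}.
Proof.
move=> e; rewrite inE => /existsP[u /existsP[v /andP[uv /eqP->]]].
by rewrite cards2; case: (u =P v) uv => // ->; rewrite eqxx.
Qed.

Lemma npartE (R : pzSemiRingType) P k : (npart k P)%:R = \sum_(a in P) (tag a == k)%:R :> R.
Proof.
rewrite /npart -sum1_card natr_sum [RHS](bigID (fun a : V => tag a == k)) /=.
rewrite [X in _ + X]big1 ?addr0 => [|a /andP[_ /negPf->]//].
by apply: eq_big => [a|a]; rewrite !inE andbC // => /andP[_ ->].
Qed.

Lemma sum_tag (R : pzSemiRingType) P (f : 'I_s -> R) :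
  \sum_(a in P) f (tag a) = \sum_k (npart k P)%:R * f k.
Proof.
under [RHS]eq_bigr do rewrite npartE mulr_suml.
rewrite exchange_big /=; apply: eq_bigr => a _.
rewrite (bigD1 (tag a)) //= eqxx mul1r big1 ?addr0 // => k.
by rewrite eq_sym => /negPf->; rewrite mul0r.
Qed.

Lemma npart_setT k : npart k [set: V] = n k.
Proof. by rewrite /npart setIT card_part. Qed.

Lemma natr_card (R : pzSemiRingType) P : #|P|%:R = \sum_(a in P) 1 :> R.
Proof. by rewrite -sum1_card natr_sum. Qed.

Lemma card_setT_multipartite : #|[set: V]|%:R = (order_total n)%:R :> rat.
Proof.
rewrite natr_card (sum_tag _ (fun=> 1)) /order_total natr_sum.
by apply: eq_bigr => k _; rewrite npart_setT mulr1.
Qed.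

(** A vertex of the [k]-th partition set has degree [n - n_k], so [alpha P] is the degree sum of
    [P]. *)
Lemma alphaE P : alpha P = \sum_k (npart k P)%:R * ((order_total n)%:R - (n k)%:R).
Proof.
under eq_bigr do rewrite mulrBr; rewrite sumrB /alpha; congr (_ - _).
  by rewrite natr_card (sum_tag _ (fun=> 1)) mulr_sumr; apply: eq_bigr => k _; rewrite mulr1 mulrC.
by apply: eq_bigr => k _; rewrite mulrC.
Qed.

(** The same edge ends, sorted by the partition set of the opposite endpoint. *)
Lemma alphaE_dual P : alpha P = \sum_k (n k)%:R * (#|P|%:R - (npart k P)%:R).
Proof.
under eq_bigr do rewrite mulrBr; rewrite sumrB /alpha; congr (_ - _).
by rewrite /order_total natr_sum mulr_suml.
Qed.

Lemma sum_adj_multipartite P Q :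
  \sum_(a in P) \sum_(b in Q) (adj G a b)%:R =
  \sum_k (npart k P)%:R * (#|Q|%:R - (npart k Q)%:R) :> rat.
Proof.
rewrite -(sum_tag P (fun k => #|Q|%:R - (npart k Q)%:R)).
apply: eq_bigr => a _; rewrite natr_card npartE -sumrB; apply: eq_bigr => b _.
by rewrite adj_multipartite eq_sym; case: eqP; rewrite ?subrr ?subr0.
Qed.

Lemma laplacian_multipartite P Q :
  laplacian rat G P Q =
  (P == Q)%:R * alpha P - \sum_k (npart k P)%:R * (#|Q|%:R - (npart k Q)%:R).
Proof.
rewrite /laplacian sum_adj_multipartite alphaE; congr (_ * _ - _).
transitivity (\sum_(a in P) \sum_(b in [set: V]) (adj G a b)%:R : rat).
  by apply: eq_bigr => a _; apply: eq_bigl => b; rewrite inE.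
rewrite sum_adj_multipartite card_setT_multipartite.
by apply: eq_bigr => k _; rewrite npart_setT.
Qed.

Lemma sum_components_card F :
  \sum_(P in components F) #|P|%:R = (order_total n)%:R :> rat.
Proof.
under eq_bigr do rewrite natr_card.
by rewrite sum_components -card_setT_multipartite natr_card; apply: eq_bigl => a; rewrite inE.
Qed.

Lemma sum_components_npart F k :
  \sum_(P in components F) (npart k P)%:R = (n k)%:R :> rat.
Proof.
under eq_bigr do rewrite npartE.
by rewrite sum_components -npart_setT npartE; apply: eq_bigl => a; rewrite inE.
Qed.

Hypotheses (hs : (2 <= s)%N) (hn : forall i, (1 <= n i)%N).

Lemma order_total_gt k : (n k < order_total n)%N.
Proof.
have [l lk] : exists l, l != k.
  have: (0 < #|[set~ k]|)%N by rewrite cardsC1 card_ord -ltnS (leq_trans _ (leqSpred _)).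
  by case/card_gt0P => l; rewrite !inE; exists l.
rewrite /order_total (bigD1 k) //= (bigD1 l) //= -addn1 leq_add2l.
exact: leq_trans (hn l) (leq_addr _ _).
Qed.

Lemma alpha_neq0 F P : P \in components F -> alpha P != 0.
Proof.
case/componentsP => r ->; have : r \in component F r by rewrite in_component connect0.
move: (component F r) => {}P Pr.
rewrite alphaE -(sum_tag P (fun k => (order_total n)%:R - (n k)%:R)) gt_eqF //.
have pos k : 0 < (order_total n)%:R - (n k)%:R :> rat by rewrite subr_gt0 ltr_nat order_total_gt.
rewrite (bigD1 r) //= ltr_wpDr // sumr_ge0 // => a _; exact: ltW.
Qed.

(** Entry [k] is the common degree of the vertices in the [k]-th partition set. *)
Definition codegree_col : 'cV[rat]_s := \col_k ((order_total n)%:R - (n k)%:R).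
Definition size_row : 'rV[rat]_s := \row_k (n k)%:R.

(** By [alphaE] the sum over [l] cancels each denominator, leaving [n - n_k] minus the sum of
    [m_p - n_kp] over all components. *)
Lemma forest_mx_codegree F : forest_mx F *m codegree_col = 0.
Proof.
apply/colP => k; rewrite !mxE.
under eq_bigr do rewrite !mxE mulrBl mulr_suml.
rewrite sumrB (bigD1 k) //= eqxx mul1r [X in _ + X - _]big1 ?addr0; last first.
  by move=> l; rewrite eq_sym => /negPf->; rewrite mul0r.
rewrite exchange_big /= -(sum_components_card F) -(sum_components_npart F k) -!sumrB.
rewrite big1 // => P FP; apply/eqP; rewrite subr_eq0 eq_sym; apply/eqP.
transitivity ((#|P|%:R - (npart k P)%:R) / alpha P * alpha P); last by rewrite divfK ?(alpha_neq0 FP).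
rewrite [X in _ = _ * X]alphaE mulr_sumr; apply: eq_bigr => l _.
by rewrite sum_components_card -!mulrA mulrCA; congr (_ * _); rewrite mulrCA.
Qed.

(** Here [alphaE_dual] cancels the denominators, leaving [n_l] minus the sum of all [n_lp]. *)
Lemma size_forest_mx F : size_row *m forest_mx F = 0.
Proof.
apply/rowP => l; rewrite !mxE.
under eq_bigr do rewrite !mxE mulrBr mulr_sumr.
rewrite sumrB (bigD1 l) //= eqxx mulr1 [X in _ + X - _]big1 ?addr0; last first.
  by move=> k /negPf->; rewrite mulr0.
rewrite exchange_big /= -(sum_components_npart F l) -sumrB.
rewrite big1 // => P FP; apply/eqP; rewrite subr_eq0 eq_sym; apply/eqP.
transitivity ((npart l P)%:R / alpha P * alpha P); last by rewrite divfK ?(alpha_neq0 FP).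
rewrite [X in _ = _ * X]alphaE_dual mulr_sumr; apply: eq_bigr => k _.
by rewrite [RHS]mulrCA mulrAC.
Qed.

End Multipartite.

Theorem theorem4p5 (s : nat) (n : 'I_s -> nat) (F : {set {set mvertex n}})
    (hs : (2 <= s)%N) (hn : forall i : 'I_s, (1 <= n i)%N)
    (hF : spanning_forest (complete_multipartite n) F) (i j : 'I_s) :
  (tau F (complete_multipartite n))%:R
  = cofactor (forest_mx F) i j
      / ((n i)%:R * ((order_total n)%:R - (n j)%:R))
      * \prod_(P in components F) alpha P.
Proof.
case/andP: hF => sFG acF.
(* Any root would do; [hn i] read as [0 < n i] supplies one in the [i]-th partition set. *)
pose r : mvertex n := Tagged (fun k => 'I_(n k)) (Ordinal (hn i)).
set C := component F r; have FC : C \in components F by exact: component_in.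
have aC := alpha_neq0 hs hn FC.
rewrite (tau_pminor rat r (@card_edge_multipartite s n) sFG acF) -/C.
rewrite (@pminor_diag_sub_mul _ _ _ _ (@alpha s n) _
  (fun P k => (npart k P)%:R) (fun k P => #|P|%:R - (npart k P)%:R)).
(* The product [u *m v] is the summand of [C] in [forest_mx F]; adding it back leaves the sum over
   the other components. *)
- pose u : 'cV[rat]_s := \col_k ((#|C|%:R - (npart k C)%:R) / alpha C).
  pose v : 'rV[rat]_s := \row_l (npart l C)%:R.
  rewrite (_ : 1%:M - _ = forest_mx F + u *m v); last first.
    apply/matrixP => k l; rewrite !mxE big_ord1 !mxE (big_setD1 C FC) /=.
    rewrite [_ *+ _](_ : _ = (k == l)%:R) // -addrA; congr (_ + _).
    rewrite opprD [X in _ = _ + X]mulrAC [X in _ = _ + X / _]mulrC addrAC addNr add0r.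
    by congr (- _); apply: eq_bigr => P _; rewrite [_ * (npart l P)%:R]mulrC.
  have := det_rank1_update_kernel u v i j
    (forest_mx_codegree hs hn F) (size_forest_mx hs hn F).
  have -> : (v *m codegree_col n) 0 0 = alpha C.
    by rewrite mxE alphaE; apply: eq_bigr => k _; rewrite !mxE.
  have -> : (size_row n *m u) 0 0 = 1.
    rewrite mxE -(divff aC) [X in _ = X / _]alphaE_dual mulr_suml.
    by apply: eq_bigr => k _; rewrite !mxE mulrA.
  rewrite mulr1 !mxE => detE.
  have ni : (n i)%:R != 0 :> rat by rewrite pnatr_eq0 -lt0n.
  have nj : (order_total n)%:R - (n j)%:R != 0 :> rat.
    by rewrite subr_eq0 eqr_nat gtn_eqF // order_total_gt.
  (* The factor [alpha C] from the kernel identity completes the product over all components. *)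
  rewrite (big_setD1 C FC) /= mulrA [RHS]mulrC; congr (_ * _).
  by rewrite mulrAC [X in X / _]mulrC -detE -mulrA mulfK // mulf_neq0.
- by move=> P; rewrite in_setD1 => /andP[_ FP]; exact: alpha_neq0 FP.
by move=> P Q _ _; exact: laplacian_multipartite.
Qed.
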